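(* There is a functor \[ \Omega:\mathbf{Top}_*\to\mathrm{HtyAlg}(\mathbf{Mon},\mathbf{Top}) \] which sends a based space $B$ to a homotopy monoid $\Omega B$ in $(\mathbf{Top},\times,1)$ with $(\Omega B)(1)\cong\mathbf{Top}_*(S^1,B)$, the space of based loops in $B$.
   Context: $\mathbf{Top}$ is the category of compactly generated Hausdorff spaces and continuous maps, made a monoidal category with equivalences via cartesian product $\times$, one-point space $1$, and homotopy equivalences as equivalences. $\mathbf{Top}_*$ is the category of based (compactly generated Hausdorff) spaces and basepoint-preserving maps; $\mathbf{Top}_*(S^1,B)$ is the space of based maps $S^1\to B$. $\Delta$: objects $n=\{0,\dots,n-1\}$ ($n\ge0$), order-preserving maps, monoidal under ordinal sum $+$ with unit $0$. $\mathrm{HtyAlg}(\mathbf{Mon},\mathbf{Top})$ is the category whose objects (homotopy monoids) are colax monoidal functors $(X,\xi):(\Delta,+,0)\to(\mathbf{Top},\times,1)$ — functors with natural, not necessarily invertible maps $\xi_{m,n}:X(m+n)\to X(m)\times X(n)$, $\xi_0:X(0)\to1$ satisfying coassociativity and counit axioms — such that $\xi_0$ and every $\xi_{m,n}$ are homotopy equivalences, and whose morphisms are monoidal transformations (natural transformations $\sigma$ with $\xi'_{m,n}\sigma_{m+n}=(\sigma_m\times\sigma_n)\xi_{m,n}$ and $\xi'_0\sigma_0=\xi_0$). *)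

(* Defs.v *)
From HB Require Import structures.
From mathcomp Require Import all_boot all_order all_algebra.
From mathcomp Require Import all_classical all_reals all_analysis.
Import numFieldNormedType.Exports.
Import Order.TTheory GRing.Theory Num.Theory.


Unset Strict Implicit.
Unset Printing Implicit Defensive.

Local Open Scope classical_set_scope.

(* k-ification of a topology (used for products / mapping spaces in the      *)
(* category of compactly generated Hausdorff spaces).                         *)

Section kification.
Context (T : topologicalType).

Definition kopen (A : set T) : Prop :=
  forall K : set T, compact K -> exists O : set T, open O /\ A `&` K = O `&` K.

Lemma kopenT : kopen setT.
Proof. by move=> K _; exists setT; split => //; exact: openT. Qed.

Lemma kopenI : setI_closed kopen.
Proof.
move=> A B hA hB K cK.
have [OA [oA eA]] := hA K cK; have [OB [oB eB]] := hB K cK.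
exists (OA `&` OB); split; first exact: openI.
apply/seteqP; split => x [[ax bx] kx].
  have : (A `&` K) x by []; rewrite eA => -[oax _].
  by have : (B `&` K) x by []; rewrite eB => -[obx _].
have : (OA `&` K) x by []; rewrite -eA => -[oax _].
by have : (OB `&` K) x by []; rewrite -eB => -[obx _].
Qed.

Lemma kopen_bigU (I : Type) (f : I -> set T) :
  (forall i, kopen (f i)) -> kopen (\bigcup_i f i).
Proof.
move=> hf K cK.
have [Os hO] := choice (fun i => hf i K cK).
exists (\bigcup_i Os i); split.
  by apply: bigcup_open => i _; case: (hO i).
rewrite !setI_bigcupl; apply: eq_bigcupr => i _; by case: (hO i).
Qed.

Definition kify : Type := T.
HB.instance Definition _ := Choice.on kify.
HB.instance Definition _ :=
  isOpenTopological.Build kify kopenT kopenI kopen_bigU.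

End kification.

Definition kprod (X Y : topologicalType) : topologicalType := kify (X * Y)%type.

Definition kspace (T : topologicalType) : Prop :=
  forall A : set T, (forall K : set T, compact K -> closed (A `&` K)) -> closed A.

Record cgh := CGH {
  cgh_sort :> topologicalType;
  cgh_hausdorff : hausdorff_space cgh_sort;
  cgh_kspace : kspace cgh_sort }.

Record ptop := PTop { pt_space :> cgh; pt_point : pt_space }.

Definition pmor (B C : ptop) :=
  {f : B -> C | continuous f /\ f (pt_point B) = pt_point C}.

Definition ptop_id (B : ptop) : pmor B B :=
  exist _ id (conj (fun x => @cvg_id _ (nbhs x)) erefl).

Lemma pcomp_subproof (B C D : ptop) (g : pmor C D) (f : pmor B C) :
  continuous (sval g \o sval f) /\
  (sval g \o sval f) (pt_point B) = pt_point D.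
Proof.
case: g => g [cg pg]; case: f => f [cf pf]; split => /=.
  by move=> x; apply: continuous_comp; [exact: cf | exact: cg].
by rewrite pf pg.
Qed.

Definition ptop_comp (B C D : ptop) (g : pmor C D) (f : pmor B C) : pmor B D :=
  exist _ (sval g \o sval f) (pcomp_subproof B C D g f).

Definition one : Type := unit.
HB.instance Definition _ := Choice.on one.
Definition one_open : set_system one := fun _ => True.
Lemma one_opT : one_open setT. Proof. by []. Qed.
Lemma one_opI : setI_closed one_open. Proof. by []. Qed.
Lemma one_op_bigU (I : Type) (f : I -> set one) :
  (forall i, one_open (f i)) -> one_open (\bigcup_i f i).
Proof. by []. Qed.
HB.instance Definition _ := isOpenTopological.Build one
  one_opT one_opI one_op_bigU.
Definition pt1 : one := tt.

Section reals.
Context (R : realType).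
Local Open Scope ring_scope.

Definition I01_set : set R := [set x | 0 <= x <= 1].
Definition I01 : topologicalType := set_type I01_set.

Lemma I01_0 : (0 : R) \in I01_set.
Proof. by apply/mem_set; rewrite /I01_set /= lexx ler01. Qed.
Lemma I01_1 : (1 : R) \in I01_set.
Proof. by apply/mem_set; rewrite /I01_set /= lexx ler01. Qed.

Definition i0 : I01 := exist _ 0 I01_0.
Definition i1 : I01 := exist _ 1 I01_1.

Definition circle_set : set (R * R) := [set p | p.1 ^+ 2 + p.2 ^+ 2 = 1].
Definition S1 : topologicalType := set_type circle_set.

Lemma S1_base_subproof : ((1, 0) : R * R) \in circle_set.
Proof. by apply/mem_set; rewrite /circle_set /= expr1n expr0n addr0. Qed.
Definition S1_base : S1 := exist _ (1, 0) S1_base_subproof.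

Definition homotopic (X Y : topologicalType) (f g : X -> Y) : Prop :=
  exists H : kprod X I01 -> Y, continuous H /\
    (forall x : X, H (x, i0) = f x) /\ (forall x : X, H (x, i1) = g x).

Definition hty_equiv (X Y : topologicalType) (f : X -> Y) : Prop :=
  continuous f /\ exists g : Y -> X, continuous g /\
    homotopic X X (g \o f) id /\ homotopic Y Y (f \o g) id.

End reals.
Arguments homotopic R {X Y}.
Arguments hty_equiv R {X Y}.
Arguments i0 {R}.
Arguments i1 {R}.

Definition homeomorphic (X Y : topologicalType) : Prop :=
  exists (f : X -> Y) (g : Y -> X),
    continuous f /\ continuous g /\ cancel f g /\ cancel g f.

Definition loop_set (R : realType) (B : ptop) : set {compact-open, S1 R -> B} :=
  [set f | continuous f /\ f (S1_base R) = pt_point B].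
Definition loops (R : realType) (B : ptop) : topologicalType :=
  kify (set_type (loop_set R B)).

(* The simplex category Delta: objects n : nat (= {0,..,n-1}), morphisms the *)
(* order-preserving maps, monoidal under ordinal sum.                         *)

Definition monotone_ord (m n : nat) (f : 'I_m -> 'I_n) : Prop :=
  forall i j : 'I_m, (i <= j)%N -> (f i <= f j)%N.
Arguments monotone_ord {m n}.

Definition dmor (m n : nat) := {f : 'I_m -> 'I_n | monotone_ord f}.

Definition did (n : nat) : dmor n n := exist (fun f : 'I_n -> 'I_n => monotone_ord f) id (fun i j h => h).

Definition dcomp (m n p : nat) (g : dmor n p) (f : dmor m n) : dmor m p :=
  exist (fun h : 'I_m -> 'I_p => monotone_ord h) (sval g \o sval f)
    (fun i j h => proj2_sig g _ _ (proj2_sig f i j h)).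
Arguments dcomp {m n p}.

Definition dcast (m n : nat) (e : m = n) : dmor m n :=
  exist (fun h : 'I_m -> 'I_n => monotone_ord h) (cast_ord e) (fun i j h => h).
Arguments dcast {m n}.

Definition dsum_fun (m n m' n' : nat) (f : 'I_m -> 'I_n) (g : 'I_m' -> 'I_n')
  (i : 'I_(m + m')) : 'I_(n + n') :=
  match fintype.split i with
  | inl a => lshift n' (f a)
  | inr b => rshift n (g b)
  end.
Arguments dsum_fun {m n m' n'}.

Lemma dsum_subproof (m n m' n' : nat) (f : dmor m n) (g : dmor m' n') :
  monotone_ord (dsum_fun (sval f) (sval g)).
Proof.
case: f => f hf; case: g => g hg i j hij; rewrite /dsum_fun /=.
case: splitP => [a ea|b eb]; case: splitP => [a' ea'|b' eb'] /=.
- by apply: hf; rewrite -ea -ea'.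
- by apply: leq_trans (ltnW (ltn_ord (f a))) (leq_addr _ _).
- by move: hij; rewrite eb ea' => /(leq_trans (leq_addr _ _)); rewrite leqNgt ltn_ord.
- by rewrite leq_add2l; apply: hg; move: hij; rewrite eb eb' leq_add2l.
Qed.

Definition dsum (m n m' n' : nat) (f : dmor m n) (g : dmor m' n') :
  dmor (m + m') (n + n') :=
  exist (fun h : 'I_(m + m') -> 'I_(n + n') => monotone_ord h) (dsum_fun (sval f) (sval g)) (dsum_subproof m n m' n' f g).
Arguments dsum {m n m' n'}.

(* HtyAlg(Mon, Top): colax monoidal functors (Delta,+,0) -> (Top,x,1) whose   *)
(* colax structure maps are homotopy equivalences, and monoidal              *)
(* transformations between them.                                             *)

Record htymon (R : realType) := HtyMon {
  hm_obj : nat -> cgh;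
  hm_map : forall m n, dmor m n -> hm_obj m -> hm_obj n;
  hm_xi : forall m n, hm_obj (m + n) -> kprod (hm_obj m) (hm_obj n);
  hm_map_cont : forall m n (f : dmor m n), continuous (hm_map m n f);
  hm_map_id : forall n (x : hm_obj n), hm_map n n (did n) x = x;
  hm_map_comp : forall m n p (f : dmor m n) (g : dmor n p) (x : hm_obj m),
    hm_map m p (dcomp g f) x = hm_map n p g (hm_map m n f x);
  hm_xi_cont : forall m n, continuous (hm_xi m n);
  hm_xi_nat : forall m n m' n' (f : dmor m n) (g : dmor m' n') (x : hm_obj (m + m')),
    hm_xi n n' (hm_map (m + m') (n + n') (dsum f g) x) =
    (hm_map m n f (hm_xi m m' x).1, hm_map m' n' g (hm_xi m m' x).2);
  (* coassociativity (Delta is strict monoidal: (m+n)+p = m+(n+p)) *)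
  hm_coassoc : forall m n p (x : hm_obj (m + n + p)),
    let y := hm_xi (m + n) p x in
    let z := hm_xi m (n + p)
               (hm_map (m + n + p) (m + (n + p)) (dcast (esym (addnA m n p))) x) in
    [/\ (hm_xi m n y.1).1 = z.1,
        (hm_xi m n y.1).2 = (hm_xi n p z.2).1 &
        y.2 = (hm_xi n p z.2).2];
  (* counit axioms (xi_0 : X(0) -> 1 is the unique map) *)
  hm_counit_l : forall n (x : hm_obj (0 + n)),
    (hm_xi 0 n x).2 = hm_map (0 + n) n (dcast (add0n n)) x;
  hm_counit_r : forall n (x : hm_obj (n + 0)),
    (hm_xi n 0 x).1 = hm_map (n + 0) n (dcast (addn0 n)) x;
  hm_xi0_equiv : hty_equiv R (fun _ : hm_obj 0 => pt1);
  hm_xi_equiv : forall m n, hty_equiv R (hm_xi m n)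
}.

Arguments hm_obj {R}.
Arguments hm_map {R} _ {m n}.
Arguments hm_xi {R} _ m n.

(* Monoidal transformations (the condition xi'_0 sigma_0 = xi_0 is automatic, *)
(* as both sides are maps into the one-point space).                          *)
Record htymor (R : realType) (X Y : htymon R) := HtyMor {
  hmor :> forall n, hm_obj X n -> hm_obj Y n;
  hmor_cont : forall n, continuous (hmor n);
  hmor_nat : forall m n (f : dmor m n) (x : hm_obj X m),
    hmor n (hm_map X f x) = hm_map Y f (hmor m x);
  hmor_xi : forall m n (x : hm_obj X (m + n)),
    hm_xi Y m n (hmor (m + n) x) =
    (hmor m (hm_xi X m n x).1, hmor n (hm_xi X m n x).2)
}.

(* Main.v *)
(* Loop composition is only associative up to homotopy, so the monoid is spread
   over simplices: (Omega B)(n) consists of the maps from the n-simplex to B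
   that send all vertices to the base point. Delta acts by precomposition, and
   xi_{m,n} restricts a map on the (m+n)-simplex to its front m-face and its
   back n-face, which share one vertex. In the coordinates
   0 <= t_0 <= ... <= t_{m+n-1} <= 1 the map applying max(0, 2x-1) to the first
   m coordinates and min(1, 2x) to the others sends the simplex into the union
   of these two faces, because a point with some t_i > 1/2 in the first block
   has all coordinates of the second block > 1/2. It is homotopic to the
   identity through maps preserving the vertices and both faces, so gluing two
   maps along the common vertex and precomposing with it inverts xi_{m,n} up to
   homotopy. *)
Require Import Defs.
From HB Require Import structures.
From mathcomp Require Import all_boot all_order all_algebra.
From mathcomp Require Import all_classical all_reals all_analysis.
From mathcomp Require Import ring lra.
Import numFieldNormedType.Exports.
Import Order.TTheory GRing.Theory Num.Theory.

Set Implicit Arguments.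
Unset Strict Implicit.
Unset Printing Implicit Defensive.

Local Open Scope classical_set_scope.

(* [kify T] is convertible to [T], so the two topologies are kept apart by
   naming source and target explicitly. *)
Definition cont (X Y : topologicalType) (f : X -> Y) : Prop := continuous f.
Arguments cont : clear implicits.

(** * Elementary continuity lemmas and pasting along closed sets *)

Lemma cont_open (X Y : topologicalType) (f : X -> Y) :
  cont X Y f <-> forall A : set Y, open A -> open (f @^-1` A).
Proof. exact: continuousP. Qed.

Lemma cont_id (X : topologicalType) : cont X X id.
Proof. by move=> x; exact: cvg_id. Qed.

Lemma cont_comp (X Y Z : topologicalType) (f : X -> Y) (g : Y -> Z) :
  cont X Y f -> cont Y Z g -> cont X Z (fun x => g (f x)).
Proof. by move=> cf cg x; apply: continuous_comp; [exact: cf|exact: cg]. Qed.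

Lemma cont_fst (X Y : topologicalType) : cont (X * Y)%type X fst.
Proof. by move=> x; exact: cvg_fst. Qed.

Lemma cont_snd (X Y : topologicalType) : cont (X * Y)%type Y snd.
Proof. by move=> x; exact: cvg_snd. Qed.

Lemma cont_pair (P X Y : topologicalType) (f : P -> X) (g : P -> Y) :
  cont P X f -> cont P Y g -> cont P (X * Y)%type (fun p => (f p, g p)).
Proof. by move=> cf cg p; apply: cvg_pair; [exact: cf|exact: cg]. Qed.

Lemma cont_pasting (X Y : topologicalType) (A B : set X) (f g h : X -> Y) :
  closed A -> closed B -> A `|` B = setT ->
  cont X Y f -> cont X Y g -> {in A, h =1 f} -> {in B, h =1 g} -> cont X Y h.
Proof.
move=> cA cB AB cf cg hf hg.
apply/continuous_subspace_setT; rewrite -AB.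
apply: withinU_continuous => //.
  apply: (@subspace_eq_continuous _ _ _ f).
    by move=> x xA; exact: esym (hf x xA).
  exact: continuous_subspaceT.
apply: (@subspace_eq_continuous _ _ _ g).
  by move=> x xA; exact: esym (hg x xA).
exact: continuous_subspaceT.
Qed.

(** * The k-ification and its universal property *)

Lemma kify_openP (T : topologicalType) (A : set T) :
  @open (kify T) A <-> kopen T A.
Proof. by []. Qed.

Lemma kify_cont_id (T : topologicalType) : cont (kify T) T id.
Proof. by apply/cont_open => A oA; apply/kify_openP => K _; exists A. Qed.

(** On [K] every k-open set agrees with an open set of [T], so the identity is continuous from the
    subspace [K] to [kify T] and [K] is a continuous compact image. *)
Lemma kify_compact (T : topologicalType) (K : set T) :
  compact K -> @compact (kify T) K.
Proof.
move=> cK; rewrite -[K]image_id.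
apply: (@continuous_compact T (kify T) id _ _ cK); apply/continuousP => A oA.
apply/open_subspaceP; have [W [oW eW]] := (@kify_openP T A).1 oA K cK.
by exists W.
Qed.

Lemma kify_kspace (T : topologicalType) : kspace (kify T).
Proof.
move=> A hA; rewrite -[A]setCK; apply: open_closedC.
apply/(@kify_openP T) => K cK.
have /closed_openC/(@kify_openP T)/(_ K cK)[W [oW eW]] :=
  hA K (kify_compact cK).
exists W; split => //; rewrite -eW; apply/seteqP; split => x /=.
  by move=> [nAx Kx]; split => // -[].
by move=> [nAx Kx]; split => // Ax; exact: nAx.
Qed.

(** The k-ification refines the topology, so neighbourhoods that separate points in [T] still do. *)
Lemma kify_hausdorff (T : topologicalType) :
  hausdorff_space T -> hausdorff_space (kify T).
Proof.
move=> hT p q cpq; apply: hT => A B nA nB; apply: cpq.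
  exact: (@kify_cont_id T p).
exact: (@kify_cont_id T q).
Qed.

(** Universal property of the k-ification. A k-open set agrees with an open set [W] of [T] on the
    compact image of [K], so the two preimages agree on [K]; there closedness is clear, and the
    k-space property of [X] globalizes it. *)
Lemma cont_kify (X T : topologicalType) (f : X -> T) :
  hausdorff_space X -> kspace X -> cont X T f -> cont X (kify T) f.
Proof.
move=> hX kX cf; apply/cont_open => A oA.
rewrite -[_ @^-1` _]setCK; apply: closed_openC; apply: kX => K cK.
have [W [oW eW]] : exists W, open W /\ A `&` (f @` K) = W `&` (f @` K).
  apply: ((@kify_openP T A).1 oA); apply: continuous_compact cK.
  exact: continuous_subspaceT.
have -> : ~` (f @^-1` A) `&` K = ~` (f @^-1` W) `&` K.
  apply/seteqP; split => x /= [nx Kx]; split => // ?; apply: nx.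
    have : (W `&` (f @` K)) (f x) by split => //; exists x.
    by rewrite -eW => -[].
  have : (A `&` (f @` K)) (f x) by split => //; exists x.
  by rewrite eW => -[].
apply: closedI; last exact: compact_closed.
by apply: open_closedC; move/cont_open : cf; exact.
Qed.

(** * Products and subspaces *)

Lemma prod_hausdorff (X Y : topologicalType) :
  hausdorff_space X -> hausdorff_space Y -> hausdorff_space (X * Y)%type.
Proof.
move=> hX hY p q h; rewrite [p]surjective_pairing [q]surjective_pairing.
congr (_, _).
  apply: hX => A B nA nB.
  by have [u [? ?]] := h _ _ (@cont_fst X Y p _ nA) (@cont_fst X Y q _ nB);
    exists u.1.
apply: hY => A B nA nB.
by have [u [? ?]] := h _ _ (@cont_snd X Y p _ nA) (@cont_snd X Y q _ nB);
  exists u.2.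
Qed.

Lemma cont_val (X : topologicalType) (A : set X) : cont (set_type A) X val.
Proof. exact: initial_continuous. Qed.

Lemma cont_set_type (P X : topologicalType) (A : set X) (f : P -> set_type A) :
  cont P X (fun p => val (f p)) -> cont P (set_type A) f.
Proof. exact: continuous_comp_initial. Qed.

Lemma set_type_hausdorff (X : topologicalType) (A : set X) :
  hausdorff_space X -> hausdorff_space (set_type A).
Proof.
move=> hX p q h; apply: val_inj; apply: hX => U V nU nV.
have [x [? ?]] := h _ _ (@cont_val X A p _ nU) (@cont_val X A q _ nV).
by exists (val x).
Qed.

Lemma set_type_compact (X : topologicalType) (A : set X) :
  compact A -> compact [set: set_type A].
Proof.
move=> /compact_near_coveringP cA; apply/compact_near_coveringP.
move=> I F P FF hP.
(* Compactness in near-covering form transfers once the property near a point of [X] is demanded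
   only at points coming from [A]. *)
have /cA : forall x, A x -> \forall x' \near x & i \near F,
    forall a : set_type A, val a = x' -> P i a.
  move=> x Ax.
  have [[U V] [/= [/= U' [[W oW <-] /= Wx WU] FV] UV]] :=
    hP (exist _ x (mem_set Ax) : set_type A) Logic.I.
  exists (W, V); first by split => //; apply: open_nbhs_nbhs.
  by move=> [w i] /= [Ww Vi] a aw; apply: (UV (a, i)); split => //;
     apply: WU; rewrite /= /set_val /= aw.
apply: filterS => i h a _; apply: (h (val a)) => //.
exact: set_valP.
Qed.

Lemma cont_kprod (P X Y : topologicalType) (f : P -> X) (g : P -> Y) :
  hausdorff_space P -> kspace P -> cont P X f -> cont P Y g ->
  cont P (kprod X Y) (fun p => (f p, g p)).
Proof. by move=> hP kP cf cg; apply: cont_kify => //; exact: cont_pair. Qed.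

Lemma kprod_cont_fst (X Y : topologicalType) : cont (kprod X Y) X fst.
Proof. exact: (cont_comp (@kify_cont_id (X * Y)%type) (@cont_fst X Y)). Qed.

Lemma kprod_cont_snd (X Y : topologicalType) : cont (kprod X Y) Y snd.
Proof. exact: (cont_comp (@kify_cont_id (X * Y)%type) (@cont_snd X Y)). Qed.

Lemma kprod_hausdorff (X Y : topologicalType) :
  hausdorff_space X -> hausdorff_space Y -> hausdorff_space (kprod X Y).
Proof. by move=> hX hY; apply: kify_hausdorff; exact: prod_hausdorff. Qed.

(** * Mapping spaces: the k-ified compact-open topology and the exponential law *)

Section MappingSpace.
Context (D B : topologicalType) (A : set {compact-open, D -> B}).
Hypothesis Acont : forall f, A f -> cont D B f.

Definition mapsp : topologicalType := kify (set_type A).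

Definition mk_map (f : D -> B) (Af : A f) : mapsp := exist _ f (mem_set Af).

Definition ap (f : mapsp) : D -> B := sval f.

Lemma apP (f : mapsp) : A (ap f).
Proof. exact: set_valP. Qed.

Lemma ap_inj (f g : mapsp) : ap f =1 ap g -> f = g.
Proof. by move=> fg; apply: val_inj; apply/funext. Qed.

Lemma mapsp_kspace : kspace mapsp.
Proof. exact: kify_kspace. Qed.

(** One-point sets are compact, so evaluation at a point is continuous, and open sets separating two
    values in [B] separate the maps. *)
Lemma mapsp_hausdorff : hausdorff_space B -> hausdorff_space mapsp.
Proof.
move=> hB; apply/kify_hausdorff/set_type_hausdorff => f g h; apply/funext => x.
apply: hB => U V nU nV.
have evx (k : {compact-open, D -> B}) (W : set B) : nbhs (k x) W ->
    nbhs k [set l : {compact-open, D -> B} | W (l x)].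
  rewrite nbhsE => -[W' [oW' W'kx] W'W].
  have oS := compact_open_open (@compact_set1 D x) oW'.
  have kS : [set g : D -> B | g @` [set x] `<=` W'] k by move=> _ [_ -> <-].
  apply: filterS (@open_nbhs_nbhs {compact-open, D -> B} k _ (conj oS kS)).
  by move=> l /= lW; apply: W'W; apply: lW; exists x.
have [k [? ?]] := h _ _ (evx _ _ nU) (evx _ _ nV).
by exists (k x).
Qed.

(** Currying half of the exponential law; the Hausdorff k-space [P] lets the curried map lift to the
    k-ification. *)
Lemma cont_mapsp (P : topologicalType) (F : P -> mapsp) :
  hausdorff_space P -> kspace P ->
  cont (P * D)%type B (fun q => ap (F q.1) q.2) -> cont P mapsp F.
Proof.
move=> hP kP cF; apply: cont_kify => //; apply: cont_set_type.
exact: (continuous_curry_fun cF).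
Qed.

Lemma cont_ap_fun : cont mapsp {compact-open, D -> B} ap.
Proof. exact: (cont_comp (@kify_cont_id (set_type A)) (@cont_val _ A)). Qed.

(** Evaluation half of the exponential law: a compact Hausdorff [D] is locally compact, so
    evaluation is jointly continuous already for the ordinary product topology. *)
Lemma cont_ap (P : topologicalType) (F : P -> mapsp) (s : P -> D) :
  compact [set: D] -> hausdorff_space D -> cont P mapsp F -> cont P D s ->
  cont P B (fun p => ap (F p) (s p)).
Proof.
move=> cD hD cF cs.
apply: (@cont_comp _ (mapsp * D)%type _ (fun p => (F p, s p))
  (fun q => ap q.1 q.2)); first exact: cont_pair.
have -> : (fun q : mapsp * D => ap q.1 q.2) = uncurry ap.
  by apply/funext => -[].
apply: continuous_uncurry => //.
- move=> x _; rewrite withinET; exists setT; first exact: filterT.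
  by split => //; exact: closedT.
- exact: cont_ap_fun.
- by move=> u; apply: Acont; exact: apP.
Qed.

End MappingSpace.

(** * Continuous real-valued functions and closed conditions *)

Section RealValued.
Context (R : realType) (P : topologicalType).
Implicit Types f g : P -> R.
Local Open Scope ring_scope.

Lemma cont_cst (Y : topologicalType) (y : Y) : cont P Y (fun=> y).
Proof. by move=> p; exact: cvg_cst. Qed.

Lemma contD f g : cont P R f -> cont P R g -> cont P R (fun p => f p + g p).
Proof. by move=> cf cg p; apply: cvgD; [exact: cf|exact: cg]. Qed.

Lemma contB f g : cont P R f -> cont P R g -> cont P R (fun p => f p - g p).
Proof. by move=> cf cg p; apply: cvgB; [exact: cf|exact: cg]. Qed.

Lemma contN f : cont P R f -> cont P R (fun p => - f p).
Proof. by move=> cf p; apply: cvgN; exact: cf. Qed.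

Lemma contM f g : cont P R f -> cont P R g -> cont P R (fun p => f p * g p).
Proof. by move=> cf cg p; apply: cvgM; [exact: cf|exact: cg]. Qed.

Lemma cont_max f g :
  cont P R f -> cont P R g -> cont P R (fun p => Num.max (f p) (g p)).
Proof. by move=> cf cg p; apply: continuous_max; [exact: cf|exact: cg]. Qed.

Lemma cont_min f g :
  cont P R f -> cont P R g -> cont P R (fun p => Num.min (f p) (g p)).
Proof. by move=> cf cg p; apply: continuous_min; [exact: cf|exact: cg]. Qed.

Lemma cont_norm f : cont P R f -> cont P R (fun p => `|f p|).
Proof. by move=> cf; apply: cont_comp cf _; exact: norm_continuous. Qed.

Lemma cont_sqrt f : cont P R f -> cont P R (fun p => Num.sqrt (f p)).
Proof. by move=> cf; apply: cont_comp cf _; exact: sqrt_continuous. Qed.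

Lemma closed_le_fun f g :
  cont P R f -> cont P R g -> closed [set p | f p <= g p].
Proof.
move=> cf cg; have := contB cf cg.
rewrite [X in closed X](_ : _ = (fun p => f p - g p) @^-1` [set x | x <= 0]).
  by move=> /continuous_closedP; apply; exact: closed_le.
by apply/seteqP; split => p /=; rewrite subr_le0.
Qed.

Lemma closed_forall (I : Type) (Q : I -> P -> Prop) :
  (forall i, closed [set p | Q i p]) -> closed [set p | forall i, Q i p].
Proof.
move=> cQ; rewrite [X in closed X](_ : _ = \bigcap_i [set p | Q i p]).
  by apply: closed_bigI => i _; exact: cQ.
by apply/seteqP; split => p /= h i; [move=> _; exact: h|exact: h].
Qed.

End RealValued.

(** * Ordinal sums of monotone maps, block by block *)

Lemma dsum_lshift m n m' n' (f : dmor m n) (g : dmor m' n') i :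
  sval (dsum f g) (lshift m' i) = lshift n' (sval f i).
Proof.
rewrite /= /dsum_fun; case: split_ordP => j; first by move/lshift_inj => <-.
by move/eqP; rewrite eq_lrshift.
Qed.

Lemma dsum_rshift m n m' n' (f : dmor m n) (g : dmor m' n') i :
  sval (dsum f g) (rshift m i) = rshift n (sval g i).
Proof.
rewrite /= /dsum_fun; case: split_ordP => j; last by move/rshift_inj => <-.
by move/eqP; rewrite eq_rlshift.
Qed.

(** * Simplices, their faces and the deformation onto two faces *)

Section Simplex.
Context (R : realType).
Local Open Scope ring_scope.

(* The n-simplex in the coordinates 0 <= t_0 <= ... <= t_(n-1) <= 1, in which
   Delta acts contravariantly by precomposition and the vertices are the
   {0,1}-valued points. *)
Definition simplex_set (n : nat) : set {ptws 'I_n -> R} :=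
  [set t | (forall i, 0 <= t i <= 1) /\
           (forall i j : 'I_n, (i <= j)%N -> t i <= t j)].

Definition simplex (n : nat) : topologicalType := set_type (@simplex_set n).

Definition co n (t : simplex n) (i : 'I_n) : R := sval t i.

Definition mk_simplex n (t : 'I_n -> R) (ht : simplex_set t) : simplex n :=
  exist _ t (mem_set ht).

Lemma coP n (t : simplex n) : simplex_set (co t).
Proof. exact: set_valP. Qed.

Lemma co_bound n (t : simplex n) i : 0 <= co t i <= 1.
Proof. by have [+ _] := coP t; exact. Qed.

Lemma co_le n (t : simplex n) (i j : 'I_n) : (i <= j)%N -> co t i <= co t j.
Proof. by have [_] := coP t; exact. Qed.

Lemma co_inj n (s t : simplex n) : co s =1 co t -> s = t.
Proof. by move=> st; apply: val_inj; apply/funext. Qed.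

Lemma cont_ptws (P : topologicalType) n (f : P -> {ptws 'I_n -> R}) :
  (forall i, cont P R (fun p => f p i)) -> cont P {ptws 'I_n -> R} f.
Proof.
move=> cf p; apply/cvg_sup => i.
apply: (@continuous_comp_initial {ptws 'I_n -> R} P R (fun g => g i) f).
exact: cf.
Qed.

Lemma cont_ptws_proj n (i : 'I_n) : cont {ptws 'I_n -> R} R (fun f => f i).
Proof. exact: (@proj_continuous _ (fun=> R) i). Qed.

Lemma cont_simplex (P : topologicalType) n (f : P -> simplex n) :
  (forall i, cont P R (fun p => co (f p) i)) -> cont P (simplex n) f.
Proof. by move=> cf; apply: cont_set_type; exact: cont_ptws. Qed.

Lemma cont_co (P : topologicalType) n (f : P -> simplex n) i :
  cont P (simplex n) f -> cont P R (fun p => co (f p) i).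
Proof.
move=> cf; apply: (@cont_comp _ _ _ f (fun t => co t i) cf).
exact: (cont_comp (@cont_val _ (@simplex_set n)) (@cont_ptws_proj n i)).
Qed.

Lemma simplex_hausdorff n : hausdorff_space (simplex n).
Proof.
apply: set_type_hausdorff.
by apply: (@hausdorff_product _ (fun=> R)) => _; exact: norm_hausdorff.
Qed.

(** The simplex is cut out by closed conditions in the cube, which is compact by Tychonoff. *)
Lemma simplex_compact n : compact [set: simplex n].
Proof.
apply: set_type_compact.
apply: (@subclosed_compact _ _ [set t : {ptws 'I_n -> R} |
   forall i, `[0, 1]%classic (t i)]).
- apply: closedI.
    apply: closed_forall => i.
    rewrite [X in closed X](_ : _ = [set t : {ptws 'I_n -> R} | 0 <= t i] `&`
      [set t : {ptws 'I_n -> R} | t i <= 1]).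
      apply: closedI.
        exact: (closed_le_fun (@cont_cst _ R 0) (@cont_ptws_proj n i)).
      exact: (closed_le_fun (@cont_ptws_proj n i) (@cont_cst _ R 1)).
    by apply/seteqP; split => t /=; [move/andP|move=> [-> ->]].
  apply: closed_forall => i; apply: closed_forall => j.
  have [ij|nij] := boolP (i <= j)%N.
    rewrite [X in closed X](_ : _ = [set t : {ptws 'I_n -> R} | t i <= t j]).
      exact: (closed_le_fun (@cont_ptws_proj n i) (@cont_ptws_proj n j)).
    by apply/seteqP; split => t /=; [exact|].
  by rewrite [X in closed X](_ : _ = setT); [exact: closedT|apply/seteqP].
- exact: (@tychonoff 'I_n (fun=> R) (fun=> `[0, 1]%classic)
    (fun=> @segment_compact R 0 1)).
- by move=> t [h _] i /=; rewrite in_itv /=; exact: h.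
Qed.

Definition vertex n : set (simplex n) :=
  [set t | forall i, co t i = 0 \/ co t i = 1].

Lemma pull_subproof m n (f : dmor m n) (t : simplex n) :
  simplex_set (fun i => co t (sval f i)).
Proof.
split=> [i|i j ij]; first exact: co_bound.
by apply: co_le; exact: (proj2_sig f).
Qed.

Definition pull m n (f : dmor m n) (t : simplex n) : simplex m :=
  mk_simplex (pull_subproof f t).

Lemma front_subproof m n (t : simplex m) :
  simplex_set (fun i : 'I_(m + n) =>
    match fintype.split i with inl a => co t a | inr _ => 1 end).
Proof.
split=> [i|i j].
  by case: split_ordP => a _; rewrite ?co_bound// ler01 lexx.
case: split_ordP => a ->; case: split_ordP => b -> //=.
- exact: co_le.
- by move=> _; have /andP[] := co_bound t a.
- by move=> /(leq_trans (leq_addr _ _)); rewrite leqNgt ltn_ord.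
Qed.

(** The front face is where the last [n] coordinates are 1. It meets the back face, where the first
    [m] are 0, exactly in the vertex with [m] zeros followed by [n] ones. *)
Definition front m n (t : simplex m) : simplex (m + n) :=
  mk_simplex (front_subproof n t).

Lemma back_subproof m n (t : simplex n) :
  simplex_set (fun i : 'I_(m + n) =>
    match fintype.split i with inl _ => 0 | inr b => co t b end).
Proof.
split=> [i|i j].
  by case: split_ordP => a _; rewrite ?co_bound// ler01 lexx.
case: split_ordP => a ->; case: split_ordP => b -> //=.
- by move=> _; have /andP[] := co_bound t b.
- by move=> /(leq_trans (leq_addr _ _)); rewrite leqNgt ltn_ord.
- by rewrite leq_add2l; exact: co_le.
Qed.

Definition back m n (t : simplex n) : simplex (m + n) :=
  mk_simplex (back_subproof m t).

Lemma lpart_subproof m n (t : simplex (m + n)) :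
  simplex_set (fun i : 'I_m => co t (lshift n i)).
Proof. by split=> [i|i j ij]; [exact: co_bound|exact: co_le]. Qed.

Definition lpart m n (t : simplex (m + n)) : simplex m :=
  mk_simplex (lpart_subproof t).

Lemma rpart_subproof m n (t : simplex (m + n)) :
  simplex_set (fun i : 'I_n => co t (rshift m i)).
Proof.
by split=> [i|i j ij]; [exact: co_bound|apply: co_le; rewrite leq_add2l].
Qed.

Definition rpart m n (t : simplex (m + n)) : simplex n :=
  mk_simplex (rpart_subproof t).

Lemma co_pull m n (f : dmor m n) (t : simplex n) i :
  co (pull f t) i = co t (sval f i).
Proof. by []. Qed.

Lemma co_lpart m n (t : simplex (m + n)) i : co (lpart t) i = co t (lshift n i).
Proof. by []. Qed.

Lemma co_rpart m n (t : simplex (m + n)) i : co (rpart t) i = co t (rshift m i).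
Proof. by []. Qed.

Lemma co_frontl m n (t : simplex m) i : co (front n t) (lshift n i) = co t i.
Proof.
rewrite /co /=; case: split_ordP => j; first by move/lshift_inj => <-.
by move/eqP; rewrite eq_lrshift.
Qed.

Lemma co_frontr m n (t : simplex m) i : co (front n t) (rshift m i) = 1.
Proof.
by rewrite /co /=; case: split_ordP => j // /eqP; rewrite eq_rlshift.
Qed.

Lemma co_backl m n (t : simplex n) i : co (back m t) (lshift n i) = 0.
Proof.
by rewrite /co /=; case: split_ordP => j // /eqP; rewrite eq_lrshift.
Qed.

Lemma co_backr m n (t : simplex n) i : co (back m t) (rshift m i) = co t i.
Proof.
rewrite /co /=; case: split_ordP => j; last by move/rshift_inj => <-.
by move/eqP; rewrite eq_rlshift.
Qed.

(* [lo l] and [hi l] are homotopies, rel 0 and 1 and through monotone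
   self-maps of the interval, from the truncations max(0, 2x-1) and min(1, 2x)
   at [l = 0] to the identity at [l = 1]. *)
Definition lo (l x : R) : R := Num.max 0 (x - (1 - x) * (1 - l)).
Definition hi (l x : R) : R := Num.min 1 (x + x * (1 - l)).

Lemma lo0 l : 0 <= l <= 1 -> lo l 0 = 0.
Proof. by move=> h; rewrite /lo; apply/max_idPl; nra. Qed.
Lemma lo1 l : lo l 1 = 1.
Proof. by rewrite /lo subrr mul0r subr0; apply/max_idPr. Qed.
Lemma hi0 l : hi l 0 = 0.
Proof. by rewrite /hi mul0r addr0; apply/min_idPr. Qed.
Lemma hi1 l : 0 <= l <= 1 -> hi l 1 = 1.
Proof. by move=> h; rewrite /hi; apply/min_idPl; nra. Qed.
Lemma lo_id x : 0 <= x -> lo 1 x = x.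
Proof. by move=> h; rewrite /lo subrr mulr0 subr0; apply/max_idPr. Qed.
Lemma hi_id x : x <= 1 -> hi 1 x = x.
Proof. by move=> h; rewrite /hi subrr mulr0 addr0; apply/min_idPr. Qed.
Lemma lo_half x : x <= 2^-1 -> lo 0 x = 0.
Proof. by move=> h; rewrite /lo; apply/max_idPl; lra. Qed.
Lemma hi_half x : 2^-1 <= x -> hi 0 x = 1.
Proof. by move=> h; rewrite /hi; apply/min_idPl; lra. Qed.
Lemma lo_bound l x : 0 <= l <= 1 -> 0 <= x <= 1 -> 0 <= lo l x <= 1.
Proof. by move=> hl hx; rewrite /lo le_max lexx ge_max ler01/=; nra. Qed.
Lemma hi_bound l x : 0 <= l <= 1 -> 0 <= x <= 1 -> 0 <= hi l x <= 1.
Proof. by move=> hl hx; rewrite /hi le_min ge_min lexx ler01/= andbT; nra. Qed.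
Lemma lo_le l x y : 0 <= l <= 1 -> x <= y -> lo l x <= lo l y.
Proof.
by move=> hl hx; rewrite /lo ge_max !le_max lexx/=; apply/orP; right; nra.
Qed.
Lemma hi_le l x y : 0 <= l <= 1 -> x <= y -> hi l x <= hi l y.
Proof.
by move=> hl hx; rewrite /hi le_min !ge_min lexx/=; apply/orP; right; nra.
Qed.
(** On the unit interval [lo l] lies below the identity and [hi l] above it; this keeps the two
    blocks of a deformed point in order. *)
Lemma lo_hi l x y : 0 <= l <= 1 -> 0 <= x -> x <= y -> y <= 1 ->
  lo l x <= hi l y.
Proof.
by move=> hl x0 xy y1; rewrite /lo /hi ge_max !le_min ler01/=; apply/and3P;
  split; nra.
Qed.

Lemma loP n (l : I01 R) (t : simplex n) :
  simplex_set (fun i => lo (sval l) (co t i)).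
Proof.
have hl : 0 <= sval l <= 1 := set_valP l.
split=> [i|i j ij]; first by apply: lo_bound => //; exact: co_bound.
by apply: lo_le => //; exact: co_le.
Qed.

(** The restriction of the deformation [slohi] to the front face, which is preserved because [hi l]
    fixes 1. Likewise [shi] is its restriction to the back face, as [lo l] fixes 0. *)
Definition slo n (l : I01 R) (t : simplex n) : simplex n :=
  mk_simplex (loP l t).

Lemma hiP n (l : I01 R) (t : simplex n) :
  simplex_set (fun i => hi (sval l) (co t i)).
Proof.
have hl : 0 <= sval l <= 1 := set_valP l.
split=> [i|i j ij]; first by apply: hi_bound => //; exact: co_bound.
by apply: hi_le => //; exact: co_le.
Qed.

Definition shi n (l : I01 R) (t : simplex n) : simplex n :=
  mk_simplex (hiP l t).

Lemma lohiP m n (l : I01 R) (t : simplex (m + n)) :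
  simplex_set (fun i : 'I_(m + n) => match fintype.split i with
    | inl _ => lo (sval l) (co t i) | inr _ => hi (sval l) (co t i) end).
Proof.
have hl : 0 <= sval l <= 1 := set_valP l.
split=> [i|i j].
  by case: split_ordP => ? _; [apply: lo_bound|apply: hi_bound] => //;
    exact: co_bound.
case: split_ordP => a ->; case: split_ordP => b -> ij.
- by apply: lo_le => //; exact: co_le.
- have /andP[? _] := co_bound t (lshift n a).
  have /andP[_ ?] := co_bound t (rshift m b).
  by apply: lo_hi => //; exact: co_le.
- by move: ij => /= /(leq_trans (leq_addr _ _)); rewrite leqNgt ltn_ord.
- by apply: hi_le => //; exact: co_le.
Qed.

Definition slohi m n (l : I01 R) (t : simplex (m + n)) : simplex (m + n) :=
  mk_simplex (lohiP l t).

Lemma co_slohil m n l (t : simplex (m + n)) i :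
  co (slohi l t) (lshift n i) = lo (sval l) (co t (lshift n i)).
Proof.
by rewrite {1}/co /=; case: split_ordP => j // /eqP; rewrite eq_lrshift.
Qed.

Lemma co_slohir m n l (t : simplex (m + n)) i :
  co (slohi l t) (rshift m i) = hi (sval l) (co t (rshift m i)).
Proof.
by rewrite {1}/co /=; case: split_ordP => j // /eqP; rewrite eq_rlshift.
Qed.

Lemma slo1 n (t : simplex n) : slo i1 t = t.
Proof. by apply: co_inj => i; apply: lo_id; have /andP[] := co_bound t i. Qed.

Lemma shi1 n (t : simplex n) : shi i1 t = t.
Proof. by apply: co_inj => i; apply: hi_id; have /andP[] := co_bound t i. Qed.

Lemma slohi1 m n (t : simplex (m + n)) : slohi i1 t = t.
Proof.
apply: co_inj => i; have /andP[? ?] := co_bound t i.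
by case: (split_ordP i) => j ij; subst i; rewrite ?co_slohil ?co_slohir;
  [exact: lo_id|exact: hi_id].
Qed.

(** [hi 0] is 1 from 1/2 on, so the second block becomes constantly 1 and the point lands in the
    front face. Dually, [lo 0] is 0 up to 1/2, which gives the back face. *)
Lemma slohi0l m n (t : simplex (m + n)) : (forall j, 2^-1 <= co (rpart t) j) ->
  slohi i0 t = front n (slo i0 (lpart t)).
Proof.
move=> ht; apply: co_inj => i; case: (split_ordP i) => j ->.
  by rewrite co_frontl co_slohil.
by rewrite co_frontr co_slohir; apply: hi_half; exact: ht.
Qed.

Lemma slohi0r m n (t : simplex (m + n)) : (forall i, co (lpart t) i <= 2^-1) ->
  slohi i0 t = back m (shi i0 (rpart t)).
Proof.
move=> ht; apply: co_inj => i; case: (split_ordP i) => j ->.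
  by rewrite co_backl co_slohil; apply: lo_half; exact: ht.
by rewrite co_backr co_slohir.
Qed.

(** If some coordinate of the second block is below 1/2, monotonicity bounds the whole first block
    by it. *)
Lemma half_cover m n (t : simplex (m + n)) :
  (forall j, 2^-1 <= co (rpart t) j) \/ (forall i, co (lpart t) i <= 2^-1).
Proof.
have [?|/existsNP[j /negP]] := pselect (forall j, 2^-1 <= co (rpart t) j).
  by left.
rewrite -ltNge => tj; right => i; apply: le_trans (ltW tj).
apply: (@co_le _ t (lshift n i) (rshift m j)) => /=.
exact: leq_trans (ltnW (ltn_ord i)) (leq_addr _ _).
Qed.

Lemma lpart_front m n (t : simplex m) : lpart (front n t) = t.
Proof. by apply: co_inj => i; exact: co_frontl. Qed.

Lemma rpart_back m n (t : simplex n) : rpart (back m t) = t.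
Proof. by apply: co_inj => i; exact: co_backr. Qed.

Lemma vertex_pull m n (f : dmor m n) t : vertex t -> vertex (pull f t).
Proof. by move=> vt i; exact: vt. Qed.

Lemma vertex_front m n (t : simplex m) : vertex t -> vertex (front n t).
Proof.
move=> vt i; case: (split_ordP i) => j ->; first by rewrite co_frontl.
by right; rewrite co_frontr.
Qed.

Lemma vertex_back m n (t : simplex n) : vertex t -> vertex (back m t).
Proof.
move=> vt i; case: (split_ordP i) => j ->; last by rewrite co_backr.
by left; rewrite co_backl.
Qed.

Lemma vertex_slo n l (t : simplex n) : vertex t -> vertex (slo l t).
Proof.
have hl : 0 <= sval l <= 1 := set_valP l.
move=> vt i; rewrite /co /=.
by have [->|->] := vt i; [left; exact: lo0|right; exact: lo1].
Qed.

Lemma vertex_shi n l (t : simplex n) : vertex t -> vertex (shi l t).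
Proof.
have hl : 0 <= sval l <= 1 := set_valP l.
move=> vt i; rewrite /co /=.
by have [->|->] := vt i; [left; exact: hi0|right; exact: hi1].
Qed.

Lemma vertex_slohi m n l (t : simplex (m + n)) : vertex t -> vertex (slohi l t).
Proof.
have hl : 0 <= sval l <= 1 := set_valP l.
move=> vt i; rewrite /co /=; case: fintype.split => _; have [->|->] := vt i.
- by left; exact: lo0.
- by right; exact: lo1.
- by left; exact: hi0.
- by right; exact: hi1.
Qed.

Lemma vertex_lpart m n (t : simplex (m + n)) : vertex t -> vertex (lpart t).
Proof. by move=> vt i; exact: vt. Qed.

Lemma vertex_rpart m n (t : simplex (m + n)) : vertex t -> vertex (rpart t).
Proof. by move=> vt i; exact: vt. Qed.

(** * Continuity of the maps between simplices *)

Section SimplexContinuity.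
Context (P : topologicalType).

Lemma cont_pull m n (f : dmor m n) (s : P -> simplex n) :
  cont P (simplex n) s -> cont P (simplex m) (fun p => pull f (s p)).
Proof.
by move=> cs; apply: cont_simplex => i; exact: (@cont_co _ _ _ (sval f i) cs).
Qed.

Lemma cont_front m n (s : P -> simplex m) :
  cont P (simplex m) s -> cont P (simplex (m + n)) (fun p => front n (s p)).
Proof.
move=> cs; apply: cont_simplex => i; rewrite /co /=.
case: fintype.split => j; last exact: cont_cst.
exact: (@cont_co _ _ s j cs).
Qed.

Lemma cont_back m n (s : P -> simplex n) :
  cont P (simplex n) s -> cont P (simplex (m + n)) (fun p => back m (s p)).
Proof.
move=> cs; apply: cont_simplex => i; rewrite /co /=.
case: fintype.split => j; first exact: cont_cst.
exact: (@cont_co _ _ s j cs).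
Qed.

Lemma cont_lpart m n (s : P -> simplex (m + n)) :
  cont P (simplex (m + n)) s -> cont P (simplex m) (fun p => lpart (s p)).
Proof.
by move=> cs; apply: cont_simplex => i; exact: (@cont_co _ _ _ (lshift n i) cs).
Qed.

Lemma cont_rpart m n (s : P -> simplex (m + n)) :
  cont P (simplex (m + n)) s -> cont P (simplex n) (fun p => rpart (s p)).
Proof.
by move=> cs; apply: cont_simplex => i; exact: (@cont_co _ _ _ (rshift m i) cs).
Qed.

Lemma cont_lo (l x : P -> R) :
  cont P R l -> cont P R x -> cont P R (fun p => lo (l p) (x p)).
Proof.
move=> cl cx; apply: cont_max; first exact: cont_cst.
by apply: contB => //; apply: contM; apply: contB => //; exact: cont_cst.
Qed.

Lemma cont_hi (l x : P -> R) :
  cont P R l -> cont P R x -> cont P R (fun p => hi (l p) (x p)).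
Proof.
move=> cl cx; apply: cont_min; first exact: cont_cst.
by apply: contD => //; apply: contM => //; apply: contB => //; exact: cont_cst.
Qed.

Lemma cont_slo n (l : P -> I01 R) (s : P -> simplex n) :
  cont P (I01 R) l -> cont P (simplex n) s ->
  cont P (simplex n) (fun p => slo (l p) (s p)).
Proof.
move=> cl cs; apply: cont_simplex => i; apply: cont_lo;
  last exact: (@cont_co _ _ _ i cs).
exact: (cont_comp cl (@cont_val _ _)).
Qed.

Lemma cont_shi n (l : P -> I01 R) (s : P -> simplex n) :
  cont P (I01 R) l -> cont P (simplex n) s ->
  cont P (simplex n) (fun p => shi (l p) (s p)).
Proof.
move=> cl cs; apply: cont_simplex => i; apply: cont_hi;
  last exact: (@cont_co _ _ _ i cs).
exact: (cont_comp cl (@cont_val _ _)).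
Qed.

Lemma cont_slohi m n (l : P -> I01 R) (s : P -> simplex (m + n)) :
  cont P (I01 R) l -> cont P (simplex (m + n)) s ->
  cont P (simplex (m + n)) (fun p => slohi (l p) (s p)).
Proof.
move=> cl cs; apply: cont_simplex => i; rewrite /co /=.
have cvl := cont_comp cl (@cont_val _ _).
by case: fintype.split => _; [apply: cont_lo|apply: cont_hi] => //;
  exact: (@cont_co _ _ _ i cs).
Qed.

End SimplexContinuity.

End Simplex.

(** * The spaces of the homotopy monoid and reparametrization of their points *)

Section LoopMonoid.
Context (R : realType) (B : ptop).

Definition nerve_set (n : nat) : set {compact-open, simplex R n -> B} :=
  [set f | cont (simplex R n) B f /\ forall t, vertex t -> f t = pt_point B].

Definition nerve (n : nat) : topologicalType := mapsp (@nerve_set n).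

Lemma ap_cont n (f : nerve n) : cont (simplex R n) B (ap f).
Proof. by have [] := apP f. Qed.

Lemma ap_vertex n (f : nerve n) t : vertex t -> ap f t = pt_point B.
Proof. by have [_] := apP f; exact. Qed.

Lemma nerve_hausdorff n : hausdorff_space (nerve n).
Proof. by apply: mapsp_hausdorff; exact: cgh_hausdorff. Qed.

Lemma nerve_kspace n : kspace (nerve n).
Proof. exact: mapsp_kspace. Qed.

Definition nerve_cgh n : cgh := CGH _ (@nerve_hausdorff n) (@nerve_kspace n).

Lemma nerve_ev (P : topologicalType) n (F : P -> nerve n)
    (s : P -> simplex R n) :
  cont P (nerve n) F -> cont P (simplex R n) s ->
  cont P B (fun p => ap (F p) (s p)).
Proof.
apply: cont_ap; [by move=> f []|exact: simplex_compact|].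
exact: simplex_hausdorff.
Qed.

(** By the exponential law only joint continuity in [p] and [t] has to be checked. [G] is specified
    through its values, so the lemma covers every map built by [mk_map] from a precomposition. *)
Lemma nerve_precomp_cont (P : topologicalType) m n (F : P -> nerve m)
    (s : P -> simplex R n -> simplex R m) (G : P -> nerve n) :
  hausdorff_space P -> kspace P -> cont P (nerve m) F ->
  cont (P * simplex R n)%type (simplex R m) (fun q => s q.1 q.2) ->
  (forall p t, ap (G p) t = ap (F p) (s p t)) -> cont P (nerve n) G.
Proof.
move=> hP kP cF cs hG; apply: cont_mapsp => //.
have -> : (fun q : P * simplex R n => ap (G q.1) q.2) =
          (fun q => ap (F q.1) (s q.1 q.2)) by apply/funext => q; exact: hG.
by apply: nerve_ev => //; apply: cont_comp cF; exact: cont_fst.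
Qed.

Lemma precomp_subproof m n (s : simplex R n -> simplex R m) (f : nerve m) :
  cont (simplex R n) (simplex R m) s ->
  (forall t, vertex t -> vertex (s t)) -> nerve_set (fun t => ap f (s t)).
Proof.
move=> cs vs; split; first exact: (@cont_comp _ _ _ s _ cs (@ap_cont _ f)).
by move=> t vt; apply: ap_vertex; exact: vs.
Qed.

Definition nerve_map m n (f : dmor m n) (x : nerve m) : nerve n :=
  mk_map (precomp_subproof x (cont_pull (f := f) (@cont_id _))
    (@vertex_pull R _ _ f)).

Definition nerve_front m n (x : nerve (m + n)) : nerve m :=
  mk_map (precomp_subproof x (cont_front (n := n) (@cont_id _))
    (@vertex_front R m n)).

Definition nerve_back m n (x : nerve (m + n)) : nerve n :=
  mk_map (precomp_subproof x (cont_back (m := m) (@cont_id _))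
    (@vertex_back R m n)).

Definition nerve_lo n (l : I01 R) (x : nerve n) : nerve n :=
  mk_map (precomp_subproof x (cont_slo (@cont_cst _ (I01 R) l) (@cont_id _))
    (@vertex_slo R n l)).

Definition nerve_hi n (l : I01 R) (x : nerve n) : nerve n :=
  mk_map (precomp_subproof x (cont_shi (@cont_cst _ (I01 R) l) (@cont_id _))
    (@vertex_shi R n l)).

Definition nerve_lohi m n (l : I01 R) (x : nerve (m + n)) : nerve (m + n) :=
  mk_map (precomp_subproof x (cont_slohi (@cont_cst _ (I01 R) l) (@cont_id _))
    (@vertex_slohi R m n l)).

Lemma nerve_map_cont m n (f : dmor m n) :
  cont (nerve m) (nerve n) (nerve_map f).
Proof.
apply: (@nerve_precomp_cont _ _ _ id (fun=> pull f));
  [exact: nerve_hausdorff|exact: nerve_kspace|exact: cont_id| |by []].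
by apply: cont_pull; exact: cont_snd.
Qed.

Lemma nerve_front_cont m n : cont (nerve (m + n)) (nerve m) (@nerve_front m n).
Proof.
apply: (@nerve_precomp_cont _ (m + n) m id (fun=> front n));
  [exact: nerve_hausdorff|exact: nerve_kspace|exact: cont_id| |by []].
by apply: cont_front; exact: cont_snd.
Qed.

Lemma nerve_back_cont m n : cont (nerve (m + n)) (nerve n) (@nerve_back m n).
Proof.
apply: (@nerve_precomp_cont _ (m + n) n id (fun=> @back R m n));
  [exact: nerve_hausdorff|exact: nerve_kspace|exact: cont_id| |by []].
by apply: cont_back; exact: cont_snd.
Qed.

Section Reparametrization.
Context (P : topologicalType) (l : P -> I01 R).
Hypotheses (hP : hausdorff_space P) (kP : kspace P) (cl : cont P (I01 R) l).

Lemma nerve_lo_cont n (F : P -> nerve n) : cont P (nerve n) F ->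
  cont P (nerve n) (fun p => nerve_lo (l p) (F p)).
Proof.
move=> cF; apply: (nerve_precomp_cont (s := fun p => slo (l p)) hP kP cF) => //.
by apply: cont_slo (@cont_snd _ _); exact: cont_comp (@cont_fst _ _) cl.
Qed.

Lemma nerve_hi_cont n (F : P -> nerve n) : cont P (nerve n) F ->
  cont P (nerve n) (fun p => nerve_hi (l p) (F p)).
Proof.
move=> cF; apply: (nerve_precomp_cont (s := fun p => shi (l p)) hP kP cF) => //.
by apply: cont_shi (@cont_snd _ _); exact: cont_comp (@cont_fst _ _) cl.
Qed.

Lemma nerve_lohi_cont m n (F : P -> nerve (m + n)) : cont P (nerve (m + n)) F ->
  cont P (nerve (m + n)) (fun p => nerve_lohi (l p) (F p)).
Proof.
move=> cF.
apply: (nerve_precomp_cont (s := fun p => slohi (l p)) hP kP cF) => //.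
by apply: cont_slohi (@cont_snd _ _); exact: cont_comp (@cont_fst _ _) cl.
Qed.

End Reparametrization.

(** * The colax structure map and its homotopy inverse *)

Definition nerve_xi m n (x : nerve (m + n)) : kprod (nerve m) (nerve n) :=
  (nerve_front x, nerve_back x).

Lemma nerve_xi_cont m n :
  cont (nerve (m + n)) (kprod (nerve m) (nerve n)) (@nerve_xi m n).
Proof.
apply: cont_kprod; [exact: nerve_hausdorff|exact: nerve_kspace| |].
  exact: nerve_front_cont.
exact: nerve_back_cont.
Qed.

(** This is [x] and [y] glued along the common vertex of the two faces and precomposed with
    [slohi i0], written out on the two closed sets of [half_cover]. *)
Definition join_fun m n (x : nerve m) (y : nerve n)
    (t : simplex R (m + n)) : B :=
  if `[< forall j, 2^-1 <= co (rpart t) j >]%R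
  then ap x (slo i0 (lpart t)) else ap y (shi i0 (rpart t)).

Lemma join_funl m n (x : nerve m) (y : nerve n) (t : simplex R (m + n)) :
  (forall j, 2^-1 <= co (rpart t) j)%R ->
  join_fun x y t = ap x (slo i0 (lpart t)).
Proof. by rewrite /join_fun; case: asboolP. Qed.

(** Where both conditions hold, the first block is sent to 0 and the second to 1, so both branches
    evaluate at vertices and give the base point. *)
Lemma join_funr m n (x : nerve m) (y : nerve n) (t : simplex R (m + n)) :
  (forall i, co (lpart t) i <= 2^-1)%R ->
  join_fun x y t = ap y (shi i0 (rpart t)).
Proof.
move=> ht; rewrite /join_fun; case: asboolP => // ht'.
have vl : vertex (slo i0 (lpart t)) by move=> i; left; exact: lo_half.
have vr : vertex (shi i0 (rpart t)) by move=> i; right; exact: hi_half.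
by rewrite !ap_vertex.
Qed.

Lemma join_cont (P : topologicalType) m n (F : P -> nerve m) (G : P -> nerve n)
    (s : P -> simplex R (m + n)) :
  cont P (nerve m) F -> cont P (nerve n) G -> cont P (simplex R (m + n)) s ->
  cont P B (fun p => join_fun (F p) (G p) (s p)).
Proof.
move=> cF cG cs; have cl := cont_lpart cs; have cr := cont_rpart cs.
apply: (@cont_pasting _ _ [set p | forall j, 2^-1 <= co (rpart (s p)) j]%R
  [set p | forall i, co (lpart (s p)) i <= 2^-1]%R
  (fun p => ap (F p) (slo i0 (lpart (s p))))
  (fun p => ap (G p) (shi i0 (rpart (s p))))).
- apply: closed_forall => j.
  exact: (closed_le_fun (@cont_cst _ R _) (@cont_co _ _ _ _ j cr)).
- apply: closed_forall => i.
  exact: (closed_le_fun (@cont_co _ _ _ _ i cl) (@cont_cst _ R _)).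
- by apply/seteqP; split => // p _; exact: half_cover.
- by apply: nerve_ev => //; apply: cont_slo => //; exact: cont_cst.
- by apply: nerve_ev => //; apply: cont_shi => //; exact: cont_cst.
- by move=> p; rewrite inE => /= hp; exact: join_funl.
- by move=> p; rewrite inE => /= hp; exact: join_funr.
Qed.

Lemma join_subproof m n (x : nerve m) (y : nerve n) : nerve_set (join_fun x y).
Proof.
split.
  by apply: join_cont; [exact: cont_cst|exact: cont_cst|exact: cont_id].
move=> t vt; rewrite /join_fun; case: asboolP => _; apply: ap_vertex.
  by apply: vertex_slo; exact: vertex_lpart.
by apply: vertex_shi; exact: vertex_rpart.
Qed.

Definition join m n (xy : kprod (nerve m) (nerve n)) : nerve (m + n) :=
  mk_map (join_subproof xy.1 xy.2).

Lemma nerve_join_cont m n :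
  cont (kprod (nerve m) (nerve n)) (nerve (m + n)) (@join m n).
Proof.
apply: cont_mapsp.
- by apply: kprod_hausdorff; exact: nerve_hausdorff.
- exact: kify_kspace.
apply: join_cont (@cont_snd _ _).
  exact: cont_comp (@cont_fst _ _) (@kprod_cont_fst _ _).
exact: cont_comp (@cont_fst _ _) (@kprod_cont_snd _ _).
Qed.

(** On the front face the second block is 1 and on the back face the first block is 0, so each face
    selects its own branch of [join_fun]. *)
Lemma xi_join m n (xy : kprod (nerve m) (nerve n)) :
  nerve_xi (join xy) = (nerve_lo i0 xy.1, nerve_hi i0 xy.2).
Proof.
congr (_, _); apply: ap_inj => t; rewrite /ap /=.
  rewrite join_funl; first by rewrite lpart_front.
  by move=> j; rewrite co_rpart co_frontr; lra.
rewrite join_funr; first by rewrite rpart_back.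
by move=> i; rewrite co_lpart co_backl; lra.
Qed.

Lemma join_xi m n (x : nerve (m + n)) : join (nerve_xi x) = nerve_lohi i0 x.
Proof.
apply: ap_inj => t; rewrite /ap /=; have [ht|ht] := half_cover t.
  by rewrite join_funl// slohi0l.
by rewrite join_funr// slohi0r.
Qed.

Lemma nerve_lo1 n (x : nerve n) : nerve_lo i1 x = x.
Proof. by apply: ap_inj => t; rewrite /ap /= slo1. Qed.

Lemma nerve_hi1 n (x : nerve n) : nerve_hi i1 x = x.
Proof. by apply: ap_inj => t; rewrite /ap /= shi1. Qed.

Lemma nerve_lohi1 m n (x : nerve (m + n)) : nerve_lohi i1 x = x.
Proof. by apply: ap_inj => t; rewrite /ap /= slohi1. Qed.

Lemma I01_hausdorff : hausdorff_space (I01 R).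
Proof. by apply: set_type_hausdorff; exact: norm_hausdorff. Qed.

Lemma nerve_xi_equiv m n : hty_equiv R (@nerve_xi m n).
Proof.
split; first exact: nerve_xi_cont.
exists (@join m n); split; first exact: nerve_join_cont.
split.
  (* By [join_xi] the composite is [nerve_lohi i0]; letting the parameter run to [i1] deforms it to
     the identity. *)
  exists (fun p => nerve_lohi p.2 p.1); split; last first.
    by split=> x /=; [rewrite join_xi|rewrite nerve_lohi1].
  apply: nerve_lohi_cont (@kprod_cont_snd _ _) _ _ _ (@kprod_cont_fst _ _).
    apply: kprod_hausdorff I01_hausdorff; exact: nerve_hausdorff.
  exact: kify_kspace.
(* On the product, each factor is deformed by the restriction of [slohi] to its own face. *)
exists (fun p => (nerve_lo p.2 p.1.1, nerve_hi p.2 p.1.2)); split; last first.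
  by split=> x /=; [rewrite xi_join|rewrite nerve_lo1 nerve_hi1; case: x].
set P := kprod _ _.
have hP : hausdorff_space P.
  apply: kprod_hausdorff I01_hausdorff.
  by apply: kprod_hausdorff; exact: nerve_hausdorff.
have kP : kspace P by exact: kify_kspace.
have c1 : cont P (kprod (nerve m) (nerve n)) fst := @kprod_cont_fst _ _.
have c2 : cont P (I01 R) snd := @kprod_cont_snd _ _.
apply: cont_kprod => //.
  by apply: nerve_lo_cont => //; exact: cont_comp c1 (@kprod_cont_fst _ _).
by apply: nerve_hi_cont => //; exact: cont_comp c1 (@kprod_cont_snd _ _).
Qed.

(** * Unit, functoriality, naturality and coherence axioms *)

Lemma vertex0 (t : simplex R 0) : vertex t.
Proof. by case. Qed.

Lemma base_subproof n : nerve_set (fun _ : simplex R n => pt_point B).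
Proof. by split=> //; exact: cont_cst. Qed.

(** The only point of the 0-simplex is vacuously a vertex, so [nerve 0] has a single element and
    stationary homotopies suffice. *)
Lemma nerve0_equiv : hty_equiv R (fun _ : nerve 0 => pt1).
Proof.
split; first exact: cont_cst.
exists (fun=> mk_map (base_subproof 0)); split; first exact: cont_cst.
split; exists fst; split; try exact: kprod_cont_fst.
  by split=> x //=; apply: ap_inj => t; rewrite !ap_vertex//; exact: vertex0.
by split=> -[].
Qed.

Lemma nerve_map_id n (x : nerve n) : nerve_map (did n) x = x.
Proof.
by apply: ap_inj => t; rewrite {1}/ap /=; congr (ap x); exact: co_inj.
Qed.

Lemma nerve_map_comp m n p (f : dmor m n) (g : dmor n p) (x : nerve m) :
  nerve_map (Defs.dcomp g f) x = nerve_map g (nerve_map f x).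
Proof. by apply: ap_inj => t; rewrite /ap /=; congr (ap x); exact: co_inj. Qed.

(** Since [dsum] acts block by block, pulling back along it commutes with padding by ones or by
    zeros. *)
Lemma nerve_xi_nat m n m' n' (f : dmor m n) (g : dmor m' n')
    (x : nerve (m + m')) :
  nerve_xi (nerve_map (dsum f g) x) =
  (nerve_map f (nerve_xi x).1, nerve_map g (nerve_xi x).2).
Proof.
congr (_, _); apply: ap_inj => t; rewrite /ap /=; congr (ap x);
  apply: co_inj => i; rewrite co_pull;
  case: (split_ordP i) => j ->; rewrite ?dsum_lshift ?dsum_rshift.
- by rewrite !co_frontl.
- by rewrite !co_frontr.
- by rewrite !co_backl.
- by rewrite !co_backr.
Qed.

(** Either order of restriction picks out the same three faces. The cast preserves the numerical
    value of an index, so the coordinates match on each of the three blocks. *)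
Lemma nerve_coassoc m n p (x : nerve (m + n + p)) :
  let y := nerve_xi x in
  let z := nerve_xi (nerve_map (dcast (esym (addnA m n p))) x
             : nerve (m + (n + p))) in
  [/\ (nerve_xi y.1).1 = z.1,
      (nerve_xi y.1).2 = (nerve_xi z.2).1 &
      y.2 = (nerve_xi z.2).2].
Proof.
have castl i : sval (dcast (esym (addnA m n p))) (lshift p (lshift n i)) =
    lshift (n + p) i by exact: val_inj.
have castm i : sval (dcast (esym (addnA m n p))) (lshift p (rshift m i)) =
    rshift m (lshift p i) by exact: val_inj.
have castr i : sval (dcast (esym (addnA m n p))) (rshift (m + n) i) =
    rshift m (rshift n i) by apply: val_inj; rewrite /= addnA.
split; apply: ap_inj => t; rewrite /ap /=; congr (ap x); apply: co_inj => i;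
  rewrite co_pull; case: (split_ordP i) => [k ->|k ->];
  rewrite ?castr; try (case: (split_ordP k) => k' ->);
  by rewrite ?castl ?castm !(co_frontl, co_frontr, co_backl, co_backr).
Qed.

(** Over an empty first block [back] adds no coordinate, so it is the relabelling given by the
    cast. *)
Lemma nerve_counit_l n (x : nerve (0 + n)) :
  (nerve_xi x).2 = nerve_map (dcast (add0n n)) x.
Proof.
apply: ap_inj => t; rewrite /ap /=; congr (ap x); apply: co_inj => i.
case: (split_ordP i) => [[]//|j ->]; rewrite co_backr; congr (co t).
exact: val_inj.
Qed.

Lemma nerve_counit_r n (x : nerve (n + 0)) :
  (nerve_xi x).1 = nerve_map (dcast (addn0 n)) x.
Proof.
apply: ap_inj => t; rewrite /ap /=; congr (ap x); apply: co_inj => i.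
case: (split_ordP i) => [j ->|[]//]; rewrite co_frontl; congr (co t).
exact: val_inj.
Qed.

End LoopMonoid.

Definition loop_monoid (R : realType) (B : ptop) : htymon R :=
  HtyMon R (nerve_cgh R B) (@nerve_map R B) (@nerve_xi R B)
    (@nerve_map_cont R B) (@nerve_map_id R B) (@nerve_map_comp R B)
    (@nerve_xi_cont R B) (@nerve_xi_nat R B) (@nerve_coassoc R B)
    (@nerve_counit_l R B) (@nerve_counit_r R B) (nerve0_equiv R B)
    (@nerve_xi_equiv R B).

(** * Functoriality in the based space, by postcomposition *)

Section LoopMonoidMorphism.
Context (R : realType) (B C : ptop) (f : pmor B C).

Lemma postcomp_subproof n (x : nerve R B n) :
  @nerve_set R C n (fun t => sval f (ap x t)).
Proof.
have [cf pf] := proj2_sig f; split; last by move=> t vt; rewrite ap_vertex.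
exact: (@cont_comp _ _ _ (ap x) (sval f) (@ap_cont R B n x) cf).
Qed.

Definition nerve_post n (x : nerve R B n) : nerve R C n :=
  mk_map (postcomp_subproof x).

Lemma nerve_post_cont n : cont (nerve R B n) (nerve R C n) (@nerve_post n).
Proof.
have [cf _] := proj2_sig f.
apply: cont_mapsp; [exact: nerve_hausdorff|exact: nerve_kspace|].
apply: (@cont_comp _ _ _ (fun q => ap q.1 q.2) (sval f) _ cf).
by apply: nerve_ev; [exact: cont_fst|exact: cont_snd].
Qed.

Lemma nerve_post_nat m n (h : dmor m n) (x : nerve R B m) :
  nerve_post (nerve_map h x) = nerve_map h (nerve_post x).
Proof. by apply: ap_inj. Qed.

Lemma nerve_post_xi m n (x : nerve R B (m + n)) :
  nerve_xi (nerve_post x) =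
  (nerve_post (nerve_xi x).1, nerve_post (nerve_xi x).2).
Proof. by congr (_, _); apply: ap_inj. Qed.

Definition loop_monoid_mor : htymor R (loop_monoid R B) (loop_monoid R C) :=
  HtyMor R (loop_monoid R B) (loop_monoid R C) nerve_post nerve_post_cont
    nerve_post_nat nerve_post_xi.

End LoopMonoidMorphism.

(** * Continuous surjections from a compact space to a Hausdorff space *)

Section Quotient.
Context (D S : topologicalType) (e : D -> S).
Hypotheses (cD : compact [set: D]) (hS : hausdorff_space S).
Hypotheses (ce : cont D S e) (se : forall s, exists t, e t = s).

(** [e] is a closed map, hence a quotient map: a closed set of [S] is recovered as the image of its
    compact preimage. *)
Lemma quotient_cont (Y : topologicalType) (h : S -> Y) :
  cont D Y (fun t => h (e t)) -> cont S Y h.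
Proof.
move=> che; apply/continuous_closedP => C clC.
rewrite [X in closed X](_ : _ = e @` ((fun t => h (e t)) @^-1` C)).
  apply: compact_closed => //; apply: continuous_compact.
    exact: continuous_subspaceT.
  apply: (subclosed_compact _ cD) => //.
  by move/continuous_closedP : che; exact.
apply/seteqP; split=> [s /= Cs|_ [t /= Ct <-]//].
by have [t ts] := se s; exists t => //=; rewrite ts.
Qed.

(** A compact [K] in [S] has compact preimage and is the image of it, so the condition that [K] goes
    into [W] can be tested on [D] after composing with [e]. *)
Lemma quotient_compact_open_cont (P Y : topologicalType)
    (G : P -> {compact-open, S -> Y}) :
  cont P {compact-open, D -> Y} (fun p t => G p (e t)) ->
  cont P {compact-open, S -> Y} G.
Proof.
move=> cG p; apply/compact_open_cvgP => K W cK oW KW.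
have ceK : compact (e @^-1` K).
  apply: (subclosed_compact _ cD) => //.
  by move/continuous_closedP : ce; apply; exact: compact_closed.
have GW : [set g : D -> Y | g @` (e @^-1` K) `<=` W] (fun t => G p (e t)).
  by move=> _ [t Kt <-]; apply: KW; exists (e t).
have /compact_open_cvgP/(_ _ _ ceK oW GW) := cG p.
apply: (@filterS _ (nbhs p)) => q /= hq _ [s Ks <-].
by have [t ts] := se s; apply: hq; exists t; rewrite /= ts.
Qed.

End Quotient.

(** * The circle as the 1-simplex with its two vertices identified *)

Section Circle.
Context (R : realType).
Local Open Scope ring_scope.

(* The two arcs of the circle are parametrized by their first coordinate: u
   decreases from 2 to -2 around the circle, and [Num.sqrt] vanishing on
   negative numbers selects the half where u is positive resp. negative. *)
Definition circ_x (u : R) : R := `|u| - 1.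
Definition circ_y (u : R) : R :=
  Num.sqrt (u * (2 - u)) - Num.sqrt (- u * (2 + u)).

Lemma circ_yN u : circ_y (- u) = - circ_y u.
Proof. by rewrite /circ_y opprK opprB. Qed.

Lemma circ_y_ge0 u : 0 <= u -> circ_y u = Num.sqrt (u * (2 - u)).
Proof.
by move=> u0; rewrite /circ_y [X in _ - X]ler0_sqrtr ?subr0//; nra.
Qed.

(** For nonnegative [u] this is the identity (u - 1)^2 + u (2 - u) = 1; changing the sign of [u]
    reflects the circle in the horizontal axis. *)
Lemma circP u : -2 <= u <= 2 -> circle_set R (circ_x u, circ_y u).
Proof.
wlog u0 : u / 0 <= u => [hw|] hu.
  have [|u0] := leP 0 u; first by move/hw; apply.
  have := hw (- u); rewrite /circle_set /= /circ_x circ_yN normrN sqrrN.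
  by apply; lra.
rewrite /circle_set /= /circ_x circ_y_ge0// ger0_norm// sqr_sqrtr; last by nra.
by ring.
Qed.

(** Affine, with the vertices 0 and 1 going to 2 and -2, the two parameters of the base point;
    [unang_subproof] handles the inverse formula. *)
Definition ang (t : simplex R 1) : R := 2 - 4 * co t ord0.

Lemma ang_bound t : -2 <= ang t <= 2.
Proof. by have := co_bound t ord0; rewrite /ang; lra. Qed.

Definition wrap (t : simplex R 1) : S1 R :=
  exist _ (circ_x (ang t), circ_y (ang t)) (mem_set (circP (ang_bound t))).

Lemma unang_subproof (u : R) : -2 <= u <= 2 ->
  simplex_set (fun _ : 'I_1 => (2 - u) / 4).
Proof. by move=> hu; split=> [_|_ _ _]//; lra. Qed.

Lemma ang_inj s t : ang s = ang t -> s = t.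
Proof.
by move=> h; apply: co_inj => i; rewrite ord1; move: h; rewrite /ang; lra.
Qed.

Lemma wrap_cont : cont (simplex R 1) (S1 R) wrap.
Proof.
have ca : cont (simplex R 1) R ang.
  apply: contB; first exact: cont_cst.
  apply: contM; first exact: cont_cst.
  exact: (@cont_co _ _ _ _ ord0 (@cont_id _)).
apply: cont_set_type; apply: cont_pair.
  by apply: contB; [exact: cont_norm|exact: cont_cst].
by apply: contB; apply: cont_sqrt; apply: contM => //;
  [apply: contB => //; exact: cont_cst|
exact: contN|
   apply: contD => //; exact: cont_cst].
Qed.

Lemma wrap_surj (p : S1 R) : exists t, wrap t = p.
Proof.
have : circle_set R (val p) := set_valP p.
case e : (val p) => [x y]; rewrite /circle_set /= => xy.
have hx : -1 <= x <= 1 by nra.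
(* The first coordinate forces |u| = x + 1, and the sign of [y] selects the arc. *)
pose u := if 0 <= y then x + 1 else - (x + 1).
have hu : -2 <= u <= 2 by rewrite /u; case: ifP => _; lra.
exists (mk_simplex (unang_subproof hu)); apply: val_inj; rewrite e /=.
have -> : ang (mk_simplex (unang_subproof hu)) = u.
  by rewrite /ang /co /=; field.
have hy : circ_y (x + 1) = `|y|.
  rewrite circ_y_ge0; last by lra.
  by rewrite -sqrtr_sqr; congr Num.sqrt; lra.
have hx1 : `|x + 1| = x + 1 by rewrite ger0_norm//; lra.
rewrite /u; case: ifP => [y0|/negbT].
  by rewrite /circ_x hx1 hy ger0_norm// addrK.
rewrite -ltNge => y0.
by rewrite /circ_x circ_yN normrN hx1 hy ltr0_norm// opprK addrK.
Qed.

Lemma wrap_vertex t : vertex t -> wrap t = S1_base R.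
Proof.
move=> vt; apply: val_inj; rewrite /=.
have [->|->] : ang t = 2 \/ ang t = - 2.
- by rewrite /ang; have [->|->] := vt ord0; [left|right]; lra.
- rewrite /circ_x circ_y_ge0// subrr mulr0 sqrtr0 ger0_norm//.
  by congr (_, _); lra.
- rewrite /circ_x circ_yN circ_y_ge0// subrr mulr0 sqrtr0 oppr0 normrN.
  rewrite ger0_norm//.
  by congr (_, _); lra.
Qed.

(** Equal first coordinates make the parameters equal up to sign. If they are opposite, the second
    coordinate vanishes, which leaves the parameter 0, where the points coincide, or 2 and -2, which
    are vertices. *)
Lemma wrap_inj s t : wrap s = wrap t -> s = t \/ (vertex s /\ vertex t).
Proof.
move=> /(congr1 val) /= [/addIr/eqP]; rewrite eqr_norm2.
move=> /orP[/eqP/ang_inj|/eqP st].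
  by left.
rewrite st circ_yN => ht.
have {}ht : circ_y (ang t) = 0 by lra.
(* The vanishing square root bounds the product on one side and [ang_bound] on the other; a negative
   parameter is first replaced by its opposite. *)
have h2 : ang t * (2 - `|ang t|) = 0.
  have [a0|a0] := leP 0 (ang t).
    rewrite ger0_norm//; apply/eqP; rewrite eq_le.
    have := ht; rewrite circ_y_ge0// => /eqP; rewrite sqrtr_eq0 => ->/=.
    by have := ang_bound t; nra.
  rewrite ltr0_norm//; apply/eqP; rewrite eq_le.
  have n0 : 0 <= - ang t by lra.
  have := circ_yN (ang t); rewrite ht circ_y_ge0// oppr0 => /eqP.
  by rewrite sqrtr_eq0 => ?; have := ang_bound t; nra.
have [/eqP t0|] := boolP (ang t == 0).
  by left; apply: ang_inj; rewrite st t0 oppr0.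
move/mulfI/(_ (2 - `|ang t|) 0); rewrite h2 mulr0 => /(_ erefl) t2.
have {}t2 : ang t = 2 \/ ang t = - 2.
  by move: t2; case: (ger0P (ang t)) => _ ?; [left|right]; lra.
have vtx r : ang r = 2 \/ ang r = - 2 -> vertex r.
  by rewrite /ang => hr i; rewrite ord1; case: hr => ?; [left|right]; lra.
by right; split; apply: vtx => //; rewrite st; case: t2 => ->;
  [right|left; rewrite opprK].
Qed.

Lemma S1_hausdorff : hausdorff_space (S1 R).
Proof.
by apply: set_type_hausdorff; apply: prod_hausdorff; exact: norm_hausdorff.
Qed.

Lemma S1_compact : compact [set: S1 R].
Proof.
rewrite (_ : [set: _] = wrap @` [set: simplex R 1]).
  apply: continuous_compact; last exact: simplex_compact.
  by apply: continuous_subspaceT; exact: wrap_cont.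
by apply/seteqP; split => // p _; have [t <-] := wrap_surj p; exists t.
Qed.

(** A section obtained by choice, with no continuity claimed; continuity is recovered after
    composing with a map that is constant on the fibres of [wrap]. *)
Definition unwrap (p : S1 R) : simplex R 1 := projT1 (cid (wrap_surj p)).

Lemma unwrapK p : wrap (unwrap p) = p.
Proof. exact: projT2 (cid (wrap_surj p)). Qed.

(** * Based loops as maps on the 1-simplex *)

Context (B : ptop).

(** Two points with the same image under [wrap] are equal or both vertices, and [x] sends all
    vertices to the base point. *)
Lemma ap_unwrap (x : nerve R B 1) t : ap x (unwrap (wrap t)) = ap x t.
Proof.
have [->//|[vu vt]] := wrap_inj (unwrapK (wrap t)).
by rewrite !ap_vertex.
Qed.

Lemma loop_of_subproof (x : nerve R B 1) :
  loop_set R B (fun p => ap x (unwrap p)).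
Proof.
split=> /=.
  apply: (quotient_cont (@simplex_compact R 1) S1_hausdorff wrap_cont
    wrap_surj).
  by under eq_fun do rewrite ap_unwrap; exact: ap_cont.
have h2 : -2 <= 2 :> R by lra.
(* The parameter 2 corresponds to coordinate 0, a vertex lying over the base point of the circle. *)
pose t0 : simplex R 1 :=
  mk_simplex (unang_subproof (u := 2) (introT andP (conj h2 (lexx _)))).
have v0 : vertex t0 by move=> i; left; rewrite /co /= subrr mul0r.
by rewrite -(wrap_vertex v0) ap_unwrap ap_vertex.
Qed.

Definition loop_of (x : nerve R B 1) : loops R B :=
  mk_map (loop_of_subproof x).

Lemma of_loop_subproof (g : loops R B) :
  @nerve_set R B 1 (fun t => sval g (wrap t)).
Proof.
have [cg pg] : loop_set R B (sval g) := set_valP g.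
split; first exact: (@cont_comp _ _ _ wrap (sval g) wrap_cont cg).
by move=> t vt; rewrite wrap_vertex.
Qed.

Definition of_loop (g : loops R B) : nerve R B 1 := mk_map (of_loop_subproof g).

(** Continuity is tested after composing with [wrap], where [loop_of] turns into the continuous map
    [ap]. *)
Lemma loop_of_cont : cont (nerve R B 1) (loops R B) loop_of.
Proof.
apply: cont_kify; [exact: nerve_hausdorff|exact: nerve_kspace|].
apply: cont_set_type.
apply: (quotient_compact_open_cont (@simplex_compact R 1) S1_hausdorff wrap_cont
  wrap_surj).
have := @cont_ap_fun _ _ (@nerve_set R B 1).
have -> : @ap _ _ (@nerve_set R B 1) = (fun x t => ap x (unwrap (wrap t))).
  by apply/funext => x; apply/funext => t; rewrite ap_unwrap.
exact.
Qed.

Lemma of_loop_cont : cont (loops R B) (nerve R B 1) of_loop.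
Proof.
apply: cont_mapsp.
- by apply: mapsp_hausdorff; exact: cgh_hausdorff.
- exact: kify_kspace.
apply: (@cont_ap _ _ (loop_set R B) _ _ fst (fun q => wrap q.2)).
- by move=> ? [].
- exact: S1_compact.
- exact: S1_hausdorff.
- exact: cont_fst.
- by apply: cont_comp wrap_cont; exact: cont_snd.
Qed.

Lemma nerve1_loops : homeomorphic (nerve R B 1) (loops R B).
Proof.
exists loop_of, of_loop; split; first exact: loop_of_cont.
split; first exact: of_loop_cont.
split=> [x|g]; first by apply: ap_inj => t; exact: ap_unwrap.
apply: val_inj; apply/funext => p /=.
by rewrite -[in RHS](unwrapK p).
Qed.

End Circle.

(* There is a functor Omega : Top_* -> HtyAlg(Mon, Top) with
   (Omega B)(1) homeomorphic to Top_*(S^1, B). *)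
Theorem theorem3p2p1 (R : realType) :
  exists (Om : ptop -> htymon R)
         (Omf : forall B C : ptop, pmor B C -> htymor R (Om B) (Om C)),
    (forall (B : ptop) (n : nat) (x : hm_obj (Om B) n),
        Omf B B (ptop_id B) n x = x) /\
    (forall (B C D : ptop) (f : pmor B C) (g : pmor C D) (n : nat)
            (x : hm_obj (Om B) n),
        Omf B D (ptop_comp B C D g f) n x = Omf C D g n (Omf B C f n x)) /\
    (forall B : ptop, homeomorphic (hm_obj (Om B) 1) (loops R B)).
Proof.
exists (loop_monoid R), (@loop_monoid_mor R); split=> [B n x|].
  by apply: ap_inj.
split=> [B C D f g n x|B]; first by apply: ap_inj.
exact: nerve1_loops.
Qed.
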